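(* Let $X$ and $Y$ be Banach spaces and let $T\in\mathcal{L}(X,Y)$. If $T\in\mathrm{QNA}(X,Y)$ and $(\ker T)^\perp\subseteq\mathrm{NA}(X,\mathbb{K})$, then $T\in\mathrm{NA}(X,Y)$.
   Context: Banach spaces are over $\mathbb{K}=\mathbb{R}$ or $\mathbb{C}$; $B_X$ is the closed unit ball of $X$; $\mathcal{L}(X,Y)$ is the space of bounded linear operators with the operator norm. $T\in\mathrm{NA}(X,Y)$ if $\|Tx_0\|=\|T\|$ for some $x_0\in B_X$; in particular $\mathrm{NA}(X,\mathbb{K})$ is the set of norm attaining functionals in $X^*$. $T\in\mathrm{QNA}(X,Y)$ if there is $u\in\overline{T(B_X)}$ (norm closure) with $\|u\|=\|T\|$. $(\ker T)^\perp=\{x^*\in X^*: x^*(x)=0 \text{ for all } x\in\ker T\}$. *)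

(* Defs.v *)
From HB Require Import structures.
From mathcomp Require Import all_boot all_order all_algebra.
From mathcomp Require Import all_classical all_reals all_analysis.
From mathcomp Require Import complex.
Set Implicit Arguments.
Unset Strict Implicit.
Unset Printing Implicit Defensive.
Import Order.TTheory GRing.Theory Num.Theory numFieldNormedType.Exports.
Local Open Scope classical_set_scope.
Local Open Scope ring_scope.
Local Open Scope complex_scope.

Definition real_or_complex (R : realType) (K : numFieldType) : Prop :=
  K = R :> numFieldType \/ K = R[i] :> numFieldType.

Section NormAttainment.
Variable K : numFieldType.
Implicit Types X Y : normedModType K.

Definition unit_ball X : set X := [set x | `|x| <= 1].

(* Boundedness near 0 is the library's form of boundedness of a linear map;
   [linear_boundedP] gives the equivalent bound of the norms of T x by r |x|. *)
Definition bounded_op X Y : set {linear X -> Y} :=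
  [set T : {linear X -> Y} | bounded_near T (nbhs (0 : X))].

(* Norms take their values in K. Over the complex numbers, z <= w means that
   w - z is a nonnegative real, so every upper bound of a nonempty set of
   norms is real and [supremum] is the usual least upper bound, embedded
   in K. *)
Definition opnorm X Y (T : {linear X -> Y}) : K :=
  supremum 0 [set `|T x| | x in @unit_ball X].

Definition NA X Y : set {linear X -> Y} :=
  [set T | @bounded_op X Y T /\
     exists2 x0, @unit_ball X x0 & `|T x0| = opnorm T].

Definition QNA X Y : set {linear X -> Y} :=
  [set T | @bounded_op X Y T /\
     exists2 u, closure (T @` @unit_ball X) u & `|u| = opnorm T].

Definition ker X Y (T : {linear X -> Y}) : set X := [set x | T x = 0].

Definition dual X : set {linear X -> K^o} := @bounded_op X K^o.

Definition annihilator X (A : set X) : set {linear X -> K^o} :=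
  [set f | dual f /\ forall x, A x -> f x = 0].

End NormAttainment.

Arguments bounded_op {K} X Y.
Arguments NA {K} X Y.
Arguments QNA {K} X Y.

(* Main.v *)
(* Choose a functional f of norm at most 1 with |f u| = |u|, where u in the
   closure of T(B_X) has norm |T|. Then f o T annihilates ker T, so it attains
   its norm at some x0, and |T x0| >= |f (T x0)| = |f o T| >= |f u| = |T|, the
   second inequality because u is a limit of values of T on the ball. The
   functional comes from the Hahn-Banach theorem, proved here without extending
   functionals from subspaces: a sublinear functional that is minimal for the
   pointwise order is linear, and Zorn's lemma provides minimal ones. *)
Require Import Defs.
From HB Require Import structures.
From mathcomp Require Import all_boot all_order all_algebra.
From mathcomp Require Import all_classical all_reals all_analysis.
From mathcomp Require Import complex.
From mathcomp Require Import ring lra.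
Import Order.TTheory GRing.Theory Num.Theory.
Import numFieldNormedType.Exports.
Local Open Scope classical_set_scope.
Local Open Scope ring_scope.

(** * Hahn-Banach for sublinear functionals on a real vector space *)

Section HahnBanach.
Set Implicit Arguments.
Unset Strict Implicit.
Variables (R : realType) (V : lmodType R).
Implicit Types (p q : V -> R) (u v x y : V).

Definition sublinear p :=
  (forall x y, p (x + y) <= p x + p y) /\
  (forall (a : R) x, 0 < a -> p (a *: x) = a * p x).

Lemma sublinear0 p : sublinear p -> p 0 = 0.
Proof. by move=> [_ /(_ 2 0)]; rewrite scaler0 => /(_ ltac:(lra)); lra. Qed.

Lemma sublinear_geN p x : sublinear p -> - p (- x) <= p x.
Proof.
move=> sp; have := sp.1 x (- x); rewrite subrr sublinear0//; lra.
Qed.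

(* The hypotheses cover both a chain of sublinear functionals and the family
   of translates defining [shave] below. *)
Lemma sublinear_inf (I : Type) (D : set I) (F : I -> V -> R) :
  D !=set0 ->
  (forall x, has_lbound [set F i x | i in D]) ->
  (forall i j x y, D i -> D j ->
     exists2 k, D k & F k (x + y) <= F i x + F j y) ->
  (forall i (a : R) x, D i -> 0 < a ->
     exists2 k, D k & F k (a *: x) <= a * F i x) ->
  sublinear (fun x => inf [set F i x | i in D]).
Proof.
move=> [i0 Di0] lbF FD FZ.
have FN x : [set F i x | i in D] !=set0 by exists (F i0 x), i0.
have infZ (a : R) x : 0 < a ->
    inf [set F i (a *: x) | i in D] <= a * inf [set F i x | i in D].
  move=> a0; rewrite -ler_pdivrMl//.
  apply: lb_le_inf => [|_ [i Di <-]]; first exact: FN.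
  rewrite ler_pdivrMl//; have [k Dk Fk] := FZ i a x Di a0.
  by apply: le_trans Fk; apply: ge_inf => //; exists k.
split=> [x y|a x a0].
  rewrite -lerBlDr; apply: lb_le_inf => [|_ [i Di <-]]; first exact: FN.
  rewrite lerBlDr -lerBlDl; apply: lb_le_inf => [|_ [j Dj <-]]; first exact: FN.
  rewrite lerBlDl; have [k Dk Fk] := FD i j x y Di Dj.
  by apply: le_trans Fk; apply: ge_inf => //; exists k.
apply/eqP; rewrite eq_le infZ//=.
(* The reverse inequality is the one just proved, for the scalar [a^-1] at the point [a *: x]. *)
rewrite -ler_pdivlMl//; apply: le_trans (infZ a^-1 (a *: x) _).
  by rewrite scalerA mulVf ?gt_eqF// scale1r.
by rewrite invr_gt0.
Qed.

(* [shave p v] is sublinear, at most [p], and takes the value [- p v] or less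
   at [- v]. Hence a minimal [p] equals [shave p v], which gives
   p x + p v <= p (x + v); and any linear functional below [shave p v] agrees
   with [p] at [v]. *)
Definition shave p v x :=
  inf [set p (x + t *: v) - t * p v | t in [set t : R | 0 <= t]].

Lemma shave_lbound p v x : sublinear p ->
  has_lbound [set p (x + t *: v) - t * p v | t in [set t : R | 0 <= t]].
Proof.
move=> sp; exists (- p (- x)) => _ [t /= + <-].
(* Homogeneity is given for positive scalars only, so [t = 0] is separate. For [t > 0], use [t * p v
   = p (t *: v) <= p (x + t *: v) + p (- x)]. *)
rewrite [0 <= t]le_eqVlt => /predU1P[<-|t0].
  by rewrite scale0r addr0 mul0r subr0 sublinear_geN.
rewrite -sp.2//; have := sp.1 (x + t *: v) (- x).
rewrite addrAC subrr add0r; lra.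
Qed.

Lemma shave_le p v x t : sublinear p -> 0 <= t ->
  shave p v x <= p (x + t *: v) - t * p v.
Proof. by move=> sp t0; apply: ge_inf; [exact: shave_lbound|exists t]. Qed.

Lemma sublinear_shave p v : sublinear p -> sublinear (shave p v).
Proof.
move=> sp; apply: sublinear_inf.
- by exists 0 => /=.
- by move=> x; exact: shave_lbound.
- move=> s t x y /= s0 t0; exists (s + t); first exact: addr_ge0.
  have := sp.1 (x + s *: v) (y + t *: v).
  rewrite addrACA -scalerDl; lra.
- move=> t a x /= t0 a0; exists (a * t); first by rewrite mulr_ge0// ltW.
  by rewrite -scalerA -scalerDr sp.2// mulrBr mulrA.
Qed.

Lemma minimal_sublinear_linear p : sublinear p ->
  (forall q, sublinear q -> (forall x, q x <= p x) -> q = p) ->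
  linear (p : V -> R^o).
Proof.
move=> sp minp.
have shavep v : shave p v = p.
  apply: minp => [|x]; first exact: sublinear_shave.
  by have := shave_le v x sp (lexx 0); rewrite scale0r addr0 mul0r subr0.
have pD x v : p (x + v) = p x + p v.
  apply/eqP; rewrite eq_le sp.1 /=.
  have := shave_le v x sp ler01; rewrite shavep scale1r; lra.
(* Additivity makes [p] odd, which carries positive homogeneity over to negative scalars. *)
have pN x : p (- x) = - p x.
  by have := pD x (- x); rewrite subrr sublinear0//; lra.
move=> a x y; rewrite pD; congr (_ + _).
have [a0|a0|->] := ltrgt0P a; first by rewrite sp.2.
- rewrite -[a in LHS]opprK scaleNr pN sp.2 ?oppr_gt0//.
  by rewrite mulNr opprK.
- by rewrite !scale0r sublinear0.
Qed.

Lemma exists_minimal_sublinear p : sublinear p ->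
  exists q, [/\ sublinear q, forall x, q x <= p x &
    forall r, sublinear r -> (forall x, r x <= q x) -> r = q].
Proof.
move=> sp; pose P q := sublinear q /\ forall x, q x <= p x.
(* The pointwise order is reversed, so a maximal element for [Zorn] is a minimal functional. *)
pose le_dual (q r : {q | P q}) := `[< forall x, sval r x <= sval q x >].
have sP : P p by [].
have [|q r s /asboolP qr /asboolP rs|q r /asboolP qr /asboolP rq|A Atot|] :=
    @Zorn {q | P q} le_dual.
- by move=> q; apply/asboolP.
- by apply/asboolP => x; exact: le_trans (rs x) (qr x).
- case: q r qr rq => [q ?] [r ?] /= qr rq; apply: eq_exist; apply/funext => x.
  by apply/eqP; rewrite eq_le qr rq.
(* An infimum over the empty chain would be a mere default value, so [p] serves there. A nonempty
   chain is bounded by its pointwise infimum, finite since [- p (- x) <= - q (- x) <= q x] for each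
   [q] in it. *)
- have [A0|/set0P [q0 Aq0]] := eqVneq A set0.
    by exists (exist _ p sP) => s; rewrite A0.
  have lbA x : has_lbound [set sval q x | q in A].
    exists (- p (- x)) => _ [[q [sq qp]] Aq <-] /=.
    by apply: le_trans (sublinear_geN x sq); rewrite lerN2.
  have Pinf : P (fun x => inf [set sval q x | q in A]).
    split.
      apply: sublinear_inf => //; first by exists q0.
      - move=> q r x y Aq Ar.
        have [/asboolP qr|/asboolP rq] := Atot _ _ Aq Ar.
        + exists r => //; apply: le_trans ((svalP r).1.1 x y) _.
          by rewrite lerD2r.
        + exists q => //; apply: le_trans ((svalP q).1.1 x y) _.
          by rewrite lerD2l.
      - by move=> q a x Aq a0; exists q => //; rewrite (svalP q).1.2.
    move=> x; apply: le_trans ((svalP q0).2 x).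
    by apply: ge_inf => //; exists q0.
  exists (exist _ _ Pinf) => s As; apply/asboolP => x /=.
  by apply: ge_inf => //; exists s.
- move=> [q [sq qp]] maxq; exists q; split=> // r sr rq.
  have Pr : P r by split=> // x; exact: le_trans (rq x) (qp x).
  by have /(congr1 sval) := maxq (exist _ r Pr) ltac:(exact/asboolP).
Qed.

Theorem hahn_banach_support p u : sublinear p ->
  exists f : {linear V -> R^o}, (forall x, f x <= p x) /\ f u = p u.
Proof.
move=> sp.
have [q [sq qp minq]] := exists_minimal_sublinear (sublinear_shave u sp).
pose fL := GRing.isLinear.Build R V R^o _ q (minimal_sublinear_linear sq minq).
pose f : {linear V -> R^o} := HB.pack (q : V -> R^o) fL.
have fp x : f x <= p x.
  apply: le_trans (qp x) _.
  by have := shave_le u x sp (lexx 0); rewrite scale0r addr0 mul0r subr0.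
exists f; split=> //; apply/eqP; rewrite eq_le fp /=.
have : f (- u) <= - p u.
  apply: le_trans (qp _) _.
  have := shave_le u (- u) sp ler01.
  by rewrite scale1r addNr sublinear0// mul1r sub0r.
by rewrite linearN lerN2.
Qed.

End HahnBanach.

(** * From real-linear to complex-linear functionals, and norming functionals *)

Section Complexification.
Set Implicit Arguments.
Unset Strict Implicit.
Local Open Scope complex_scope.
Variable R : realType.

(** The alias carries the real scalar action, keeping it apart from the complex one on [V]. *)
Definition realified (V : lmodType R[i]) : Type := V.

HB.instance Definition _ (V : lmodType R[i]) := GRing.Zmodule.on (realified V).

Section RealScaling.
Variable V : lmodType R[i].

Definition scale_real (a : R) (v : realified V) : realified V :=
  (a%:C : R[i]) *: (v : V).

Lemma scale_realA (a b : R) v :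
  scale_real a (scale_real b v) = scale_real (a * b) v.
Proof. by rewrite /scale_real scalerA rmorphM. Qed.

Lemma scale_real1 : left_id 1 scale_real.
Proof. by move=> v; rewrite /scale_real rmorph1 scale1r. Qed.

Lemma scale_realDr : right_distributive scale_real +%R.
Proof. by move=> a u v; rewrite /scale_real scalerDr. Qed.

Lemma scale_realDl v : {morph scale_real^~ v : a b / a + b}.
Proof. by move=> a b; rewrite /scale_real rmorphD scalerDl. Qed.

HB.instance Definition _ := GRing.Zmodule_isLmodule.Build R (realified V)
  scale_realA scale_real1 scale_realDr scale_realDl.

(** For real-linear [f], this is the only complex-linear functional with real part [f], since the
    imaginary part of [g v] is minus the real part of [g ('i *: v)]. *)
Definition complexify (f : V -> R) (v : V) : R[i] := f v -i* f ('i *: v).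

Lemma complexify_linear (f : {linear realified V -> R^o}) :
  linear (complexify f : V -> R[i]^o).
Proof.
have fD (x y : V) : f (x + y) = f x + f y by exact: (linearD f).
have fZ (a : R) (x : V) : f ((a%:C : R[i]) *: x) = a * f x.
  by exact: (linearZ_LR f a x).
have fi (x : V) : f ('i *: ('i *: x)) = - f x.
  by rewrite scalerA -expr2 sqr_i scaleN1r; exact: (linearN f).
move=> [a b] x y.
have fab (z : V) : f ((a +i* b) *: z) = a * f z + b * f ('i *: z).
  by rewrite [a +i* b]complexE /= scalerDl fD fZ [_ * b%:C]mulrC -scalerA fZ.
rewrite /complexify scalerDr !fD scalerA [_ * (a +i* b)]mulrC -scalerA.
rewrite !fab fi; apply/eqP; rewrite eq_complex /=.
by apply/andP; split; apply/eqP; ring.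
Qed.

End RealScaling.
End Complexification.

Lemma exists_norming_functional (R : realType) (K : numFieldType)
    (hK : real_or_complex R K) (Y : normedModType K) (u : Y) :
  exists f : {linear Y -> K^o},
    (forall y, `|f y| <= `|y|) /\ `|f u| = `|u|.
Proof.
case: hK => hK; subst K.
  have sN : sublinear (fun y : Y => `|y|).
    split=> [x y|a x a0]; first exact: ler_normD.
    by rewrite normrZ gtr0_norm.
  have [f [fN fu]] := hahn_banach_support u sN.
  exists f; split; last by rewrite fu normr_id.
  move=> y; rewrite ler_norml fN andbT lerNl -linearN.
  by apply: le_trans (fN _) _; rewrite normrN.
have normE (y : Y) : ((complex.Re `|y|)%:C = `|y|)%C.
  by rewrite RRe_real// normr_real.
have sN : sublinear (fun y : realified Y => complex.Re `|y : Y|).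
  split=> [x y|a x a0].
    by rewrite -lecR rmorphD/= !normE; exact: (@ler_normD _ Y).
  apply: (@complexI R); rewrite rmorphM/= !normE.
  apply: etrans (normrZ (a%:C)%C (x : Y)) _.
  by rewrite gtr0_norm ?ltcR.
have [f [fN fu]] := hahn_banach_support (u : realified Y) sN.
pose gL := GRing.isLinear.Build R[i] Y R[i]^o _ (complexify f)
  (complexify_linear f).
pose g : {linear Y -> R[i]^o} := HB.pack (complexify f : Y -> R[i]^o) gL.
have gRe y : complex.Re (g y) = f y by [].
have gN y : `|g y| <= `|y|.
  have [->|gy0] := eqVneq (g y) 0; first by rewrite normr0.
  (* Rotating [y] makes [g y] a nonnegative real, where [g] agrees with [f]. *)
  pose a := `|g y| / g y.
  have a1 : `|a| = 1 by rewrite normrM normfV normr_id divff// normr_eq0.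
  have gay : g (a *: y) = `|g y| by rewrite linearZ /= /GRing.scale/= divfK.
  have : f (a *: y) <= complex.Re `|y|.
    by rewrite -[`|y|]mul1r -a1 -normrZ; exact: fN.
  rewrite -gRe gay => le_Re.
  by rewrite -[`|y|]normE -[`|g y|]RRe_real ?normr_real// lecR.
exists g; split=> //; apply/eqP; rewrite eq_le gN /=.
(* The real part of [g u] is [f u], which is already the norm of [u]. *)
apply: le_trans (normc_ge_Re (g u)).
by rewrite gRe fu -[leLHS]normE lecR ler_norm.
Qed.

(** * Operator norms as least upper bounds in [K] *)

Lemma nneg_supremums_neq0 (R : realType) (K : numFieldType)
    (hK : real_or_complex R K) (A : set K) :
  A !=set0 -> (forall x, A x -> 0 <= x) -> has_ubound A -> supremums A !=set0.
Proof.
case: hK => hK; subst K => A0 Age0 [M AM].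
  exists (sup A); split; first by apply: ub_le_sup; exists M.
  by move=> y Ay; exact: ge_sup.
have AE x : A x -> ((complex.Re x)%:C)%C = x.
  by move=> /Age0 x0; rewrite RRe_real// ger0_real.
pose B := @complex.Re R @` A.
have leRe (x y : R[i]) : x <= y -> complex.Re x <= complex.Re y.
  by rewrite lecE => /andP[].
have B0 : B !=set0 by case: A0 => x Ax; exists (complex.Re x), x.
have ubB : has_ubound B.
  by exists (complex.Re M) => _ [x Ax <-]; apply/leRe/AM.
exists ((sup B)%:C)%C; split=> [x Ax|y Ay].
  by rewrite -(AE _ Ax) lecR; apply: ub_le_sup => //; exists x.
(* An upper bound lies above some nonnegative element of [A], hence is itself a nonnegative real,
   and comparing real parts suffices. *)
have yE : ((complex.Re y)%:C)%C = y.
  case: A0 => x Ax; rewrite RRe_real// ger0_real//.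
  exact: le_trans (Age0 _ Ax) (Ay _ Ax).
by rewrite -yE lecR; apply: ge_sup => // _ [x Ax <-]; apply/leRe/Ay.
Qed.

Lemma supremum_ubound (d : Order.disp_t) (T : porderType d) (x0 : T)
    (A : set T) :
  supremums A !=set0 -> ubound A (supremum x0 A).
Proof.
case=> s As t At; rewrite /supremum; case: ifPn => [/eqP A0|_].
  by rewrite A0 in At.
by case: xgetP => [y _ [+ _]|/(_ s)//]; exact.
Qed.

Lemma opnorm_ub (R : realType) (K : numFieldType) (hK : real_or_complex R K)
    (X Y : normedModType K) (T : {linear X -> Y}) (x : X) :
  bounded_op X Y T -> `|x| <= 1 -> `|T x| <= opnorm T.
Proof.
move=> /linear_boundedP/pinfty_ex_gt0[M M0 TM] x1.
apply: supremum_ubound; last by exists x.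
apply: (nneg_supremums_neq0 hK).
- by exists `|T x|, x.
- by move=> _ [y _ <-].
- exists M => _ [y y1 <-]; apply: le_trans (TM y) _.
  by rewrite ler_piMr// ltW.
Qed.

Theorem proposition5p11 (R : realType) (K : numFieldType)
    (hK : real_or_complex R K) (X Y : completeNormedModType K)
    (T : {linear X -> Y}) (hT : bounded_op X Y T) :
  QNA X Y T -> annihilator (ker T) `<=` NA X K^o -> NA X Y T.
Proof.
move=> [_ [u clu uT]] perpNA.
have [f [f1 fu]] := exists_norming_functional hK u.
pose fT : {linear X -> K^o} := f \o T.
have bfT : bounded_op X K^o fT.
  apply/linear_boundedP; move/linear_boundedP: hT.
  by apply: filterS => r Tr x; exact: le_trans (f1 _) (Tr x).
have [|_ [x0 x01 fTx0]] := perpNA fT.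
  by split=> // x Tx0; rewrite /fT /= (Tx0 : T x = 0) linear0.
split=> //; exists x0 => //; apply/eqP; rewrite eq_le (opnorm_ub hK)//=.
rewrite -uT -fu; apply: le_trans (f1 (T x0)); rewrite [leRHS]fTx0.
(* Pick [T x] within [e] of [u], with [x] in the ball. As [f] is a contraction, replacing [u] by
   [T x] costs at most [e]. *)
apply/ler_addgt0Pr => e e0.
have [_ [[x x1 <-]]] := clu _ (nbhsx_ballx u _ e0).
rewrite -ball_normE /= => uTx.
have -> : f u = f (T x) + f (u - T x) by rewrite -linearD addrC subrK.
apply: le_trans (ler_normD _ _) _; apply: lerD.
  exact: (opnorm_ub hK bfT).
exact: le_trans (f1 _) (ltW uTx).
Qed.
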